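(* Let $m\le n$ be positive integers, let $A\in\mathbb{R}^{n\times n}$ be symmetric positive definite, let $C\in\mathbb{R}^{m\times m}$ be symmetric positive semidefinite, and let $B\in\mathbb{R}^{m\times n}$ have full rank (i.e. rank $m$). Let $\alpha,\beta>0$ be real numbers and let $\Gamma_{\alpha,\beta}=\mathcal{M}_{\alpha,\beta}^{-1}\mathcal{N}_{\alpha,\beta}$. If $\lambda\in\mathbb{C}$ is an eigenvalue of $\Gamma_{\alpha,\beta}$, then $|\lambda|<1$.
   Context: The matrices $\mathcal{M}_{\alpha,\beta},\mathcal{N}_{\alpha,\beta}\in\mathbb{R}^{(n+m)\times(n+m)}$ are defined by $$\mathcal{M}_{\alpha,\beta}=\frac12\begin{pmatrix}\alpha I+A & B^T\\ -B & \beta I+C\end{pmatrix},\qquad \mathcal{N}_{\alpha,\beta}=\frac12\begin{pmatrix}\alpha I-A & -B^T\\ B & \beta I-C\end{pmatrix},$$ where $I$ denotes the identity matrix of the appropriate size. They form a splitting $\mathcal{A}=\mathcal{M}_{\alpha,\beta}-\mathcal{N}_{\alpha,\beta}$ of the saddle point matrix $\mathcal{A}=\begin{pmatrix}A & B^T\\ -B & C\end{pmatrix}$. The matrix $\mathcal{M}_{\alpha,\beta}$ is nonsingular, and $\Gamma_{\alpha,\beta}$ is the iteration matrix of the stationary iteration $\mathcal{M}_{\alpha,\beta}u^{(k+1)}=\mathcal{N}_{\alpha,\beta}u^{(k)}+b$. *)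

(* Defs.v *)
(* MathComp world; the real numbers are an arbitrary [R : realType] and the
   complex numbers are [R[i]] from mathcomp-real-closed. *)
From HB Require Import structures.
From mathcomp Require Import all_boot all_order all_algebra.
From mathcomp Require Import reals.
From mathcomp Require Import complex.

Set Implicit Arguments.
Unset Strict Implicit.
Unset Printing Implicit Defensive.

Import Order.TTheory GRing.Theory Num.Theory.
Local Open Scope ring_scope.

Definition quadform (R : realType) (n : nat) (A : 'M[R]_n) (x : 'cV[R]_n) : R :=
  (x^T *m A *m x) 0 0.

Definition sym_posdef (R : realType) (n : nat) (A : 'M[R]_n) : Prop :=
  A \is symmetricmx /\ forall x : 'cV[R]_n, x != 0 -> 0 < quadform A x.

Definition sym_possemidef (R : realType) (n : nat) (A : 'M[R]_n) : Prop :=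
  A \is symmetricmx /\ forall x : 'cV[R]_n, 0 <= quadform A x.

Definition split_M (R : realType) (n m : nat)
    (A : 'M[R]_n) (B : 'M[R]_(m, n)) (C : 'M[R]_m) (alpha beta : R) :
    'M[R]_(n + m) :=
  2^-1 *: block_mx (alpha%:M + A) B^T (- B) (beta%:M + C).

Definition split_N (R : realType) (n m : nat)
    (A : 'M[R]_n) (B : 'M[R]_(m, n)) (C : 'M[R]_m) (alpha beta : R) :
    'M[R]_(n + m) :=
  2^-1 *: block_mx (alpha%:M - A) (- B^T) B (beta%:M - C).

(* [invmx] is the genuine inverse only on invertible matrices.  [split_M] is
   invertible when alpha, beta > 0, A is positive definite and C is positive
   semidefinite: the symmetric part of [split_M] is then positive definite. *)
Definition iteration_mx (R : realType) (n m : nat)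
    (A : 'M[R]_n) (B : 'M[R]_(m, n)) (C : 'M[R]_m) (alpha beta : R) :
    'M[R]_(n + m) :=
  invmx (split_M A B C alpha beta) *m split_N A B C alpha beta.

(* [eigenvalue] is defined through row eigenvectors, v *m G = lambda *: v; a
   square matrix over a field has the same eigenvalues on either side. *)
Definition complex_eigenvalue (R : realType) (k : nat)
    (G : 'M[R]_k) (lambda : R[i]) : bool :=
  eigenvalue (map_mx (real_complex R) G) lambda.

(* Main.v *)
(* Writing 2M = D + K and 2N = D - K with D = diag(alpha I, beta I) and K the
   saddle point matrix, a row eigenvector v = w M of Gamma gives
   w (D - K) = lambda w (D + K).  Pairing with w^* yields
   lambda (d + k) = d - k, where d > 0 and Re k = x A x^* + y C y^* >= 0 for
   w = (x, y).  If Re k > 0 then |d - k| < |d + k|.  Otherwise x = 0 and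
   y C = 0, so the equation reduces to (1 - lambda) beta y = 0 and
   (1 + lambda) y B = 0, which forces y = 0 because B has full row rank. *)
Require Import Defs.
From HB Require Import structures.
From mathcomp Require Import all_boot all_order all_algebra.
From mathcomp Require Import reals.
From mathcomp Require Import complex.
From mathcomp Require Import ring lra.

Set Implicit Arguments.
Unset Strict Implicit.
Unset Printing Implicit Defensive.

Import Order.TTheory GRing.Theory Num.Theory.
Local Open Scope ring_scope.

Lemma mx11D (K : pzRingType) (a b : 'M[K]_1) : (a + b) 0 0 = a 0 0 + b 0 0.
Proof. by rewrite mxE. Qed.

Lemma mx11Z (K : pzRingType) c (a : 'M[K]_1) : (c *: a) 0 0 = c * a 0 0.
Proof. by rewrite mxE. Qed.

Lemma mx11N (K : pzRingType) (a : 'M[K]_1) : (- a) 0 0 = - a 0 0.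
Proof. by rewrite mxE. Qed.

Lemma trmx11 (T : Type) (a : 'M[T]_1) : a^T ord0 ord0 = a ord0 ord0.
Proof. by rewrite mxE. Qed.

Section RealForms.
Variable R : realType.

Lemma symmetricmxP n (S : 'M[R]_n) : reflect (S = S^T) (S \is symmetricmx).
Proof.
by rewrite is_hermitianmxE expr0 scale1r map_mx_id //; apply: eqP.
Qed.

(** Bridge between the two conventions: forms take columns, while eigenvectors are rows. *)
Lemma quadform_tr n (S : 'M[R]_n) (p : 'rV[R]_n) :
  quadform S p^T = (p *m S *m p^T) 0 0.
Proof. by rewrite /quadform trmxK. Qed.

Lemma bilinear_sym n (S : 'M[R]_n) (p q : 'rV[R]_n) : S \is symmetricmx ->
  (q *m S *m p^T) 0 0 = (p *m S *m q^T) 0 0.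
Proof.
move=> /symmetricmxP symS.
by rewrite -trmx11 !trmx_mul trmxK -symS mulmxA.
Qed.

Lemma quadformD n (S T : 'M[R]_n) x :
  quadform (S + T) x = quadform S x + quadform T x.
Proof. by rewrite /quadform mulmxDr mulmxDl mxE. Qed.

Lemma quadform_scalar_gt0 n (a : R) (x : 'cV[R]_n) :
  0 < a -> x != 0 -> 0 < quadform a%:M x.
Proof.
move=> a_gt0 x_neq0; rewrite /quadform mul_mx_scalar -scalemxAl mxE.
apply: mulr_gt0 => //; rewrite mxE lt_neqAle; apply/andP; split; last first.
  by apply: sumr_ge0 => i _; rewrite mxE -expr2 sqr_ge0.
apply: contra x_neq0; rewrite eq_sym psumr_eq0; last first.
  by move=> i _; rewrite mxE -expr2 sqr_ge0.
move=> /allP x0; apply/eqP/matrixP => i j; rewrite ord1 mxE.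
have := x0 i (mem_index_enum _); rewrite implyTb mxE mulf_eq0 orbb.
by move/eqP.
Qed.

(** The two off-diagonal terms are transposed scalars with opposite signs, so they cancel. *)
Lemma quadform_block n m (S : 'M[R]_n) (B : 'M[R]_(m, n)) (T : 'M[R]_m)
    (p : 'cV[R]_n) (q : 'cV[R]_m) :
  quadform (block_mx S B^T (- B) T) (col_mx p q) = quadform S p + quadform T q.
Proof.
have cross : (p^T *m B^T *m q) 0 0 = (q^T *m B *m p) 0 0.
  by rewrite -trmx11 !trmx_mul !trmxK mulmxA.
rewrite /quadform tr_col_mx mul_row_block mul_row_col !mulmxDl mulmxN mulNmx.
by rewrite !mx11D mx11N cross; ring.
Qed.

(* Minimality of the form at [p] along the direction [z = p S]: its value at
   [p - s / (q + 1) z] would be negative if [s = z z^T] were positive. *)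
Lemma possemidef_isotropic n (S : 'M[R]_n) (p : 'rV[R]_n) :
  sym_possemidef S -> quadform S p^T = 0 -> p *m S = 0.
Proof.
case=> symS S_ge0 p_iso; apply: contraTeq isT => pS_neq0.
have s_gt0 : 0 < (p *m S *m (p *m S)^T) 0 0.
  have := @quadform_scalar_gt0 _ 1 (p *m S)^T ltr01.
  by rewrite trmx_eq0 quadform_tr mulmx1; apply.
set z := p *m S in s_gt0 *; set s := (z *m z^T) 0 0 in s_gt0.
have q_ge0 := S_ge0 z^T; set q := quadform S z^T in q_ge0.
have expand t : quadform S (p + t *: z)^T = t * s *+ 2 + t ^+ 2 * q.
  rewrite /q !quadform_tr linearD linearZ /= !mulmxDl !mulmxDr.
  rewrite -!scalemxAl -!scalemxAr !mx11D !mx11Z.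
  rewrite (bilinear_sym p z symS) -(quadform_tr S p) p_iso -/z -/s; ring.
(* For [q > 0] the minimiser is [- s / q]; the denominator [q + 1] also covers [q = 0] and still
   gives a negative value. *)
have := S_ge0 (p + (- (s / (q + 1))) *: z)^T; rewrite expand.
have q1_gt0 : 0 < q + 1 by rewrite ltr_wpDl.
have -> : - (s / (q + 1)) * s *+ 2 + (- (s / (q + 1))) ^+ 2 * q
    = - ((s / (q + 1)) ^+ 2 * (q + 2)).
  by field; rewrite gt_eqF.
rewrite oppr_ge0 leNgt; apply: contraNN => _.
by rewrite mulr_gt0 ?exprn_gt0 ?divr_gt0 // ltr_wpDl.
Qed.

(** A row [k] with [k S = 0] makes the form vanish at [k^T], so positivity leaves only [k = 0] in
    the left kernel. *)
Lemma unitmx_quadform_gt0 n (S : 'M[R]_n) :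
  (forall x, x != 0 -> 0 < quadform S x) -> S \in unitmx.
Proof.
move=> S_gt0; rewrite -row_free_unit -kermx_eq0.
apply/eqP/row_matrixP => i; rewrite row0; apply: contraTeq isT => k_neq0.
have := S_gt0 (row i (kermx S))^T; rewrite trmx_eq0 quadform_tr => /(_ k_neq0).
have /sub_kermxP -> := row_sub i (kermx S).
by rewrite mul0mx mxE ltxx.
Qed.

End RealForms.

Section ComplexForms.
Variable R : realType.
Local Notation toC := (map_mx (real_complex R)).
Local Notation re := (map_mx (@complex.Re R)).
Local Notation im := (map_mx (@complex.Im R)).

(** This is [w S w^*]. Keeping [S] real lets the real and imaginary parts of [w] separate. *)
Definition hermform n (S : 'M[R]_n) (w : 'rV[R[i]]_n) : R[i] :=
  (w *m toC S *m (map_mx conjc w)^T) 0 0.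

Lemma mx_reim m n (w : 'M[R[i]]_(m, n)) : w = toC (re w) + 'i%C *: toC (im w).
Proof.
by apply/matrixP => i j; rewrite !mxE; case: (w i j) => a b; simpc.
Qed.

(** Expand [(a + i b) S (a - i b)^T] with [a], [b] real. Positivity of real forms thus passes to
    complex vectors. *)
Lemma hermformE n (S : 'M[R]_n) (w : 'rV[R[i]]_n) :
  hermform S w = Complex (quadform S (re w)^T + quadform S (im w)^T)
    ((im w *m S *m (re w)^T) 0 0 - (re w *m S *m (im w)^T) 0 0).
Proof.
have conjw : map_mx conjc w = toC (re w) - 'i%C *: toC (im w).
  by apply/matrixP => i j; rewrite !mxE; case: (w i j) => a b; simpc.
rewrite /hermform conjw {1}[w]mx_reim linearB linearZ /= !map_trmx.
rewrite !mulmxDl !mulmxBr -!scalemxAl -!scalemxAr -!map_mxM -!map_trmx.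
by rewrite !quadform_tr !mxE; simpc; rewrite [X in Complex _ X = _]addrC.
Qed.

Lemma re_hermform n (S : 'M[R]_n) (w : 'rV[R[i]]_n) :
  complex.Re (hermform S w) = quadform S (re w)^T + quadform S (im w)^T.
Proof. by rewrite hermformE. Qed.

Lemma im_hermform n (S : 'M[R]_n) (w : 'rV[R[i]]_n) :
  S \is symmetricmx -> complex.Im (hermform S w) = 0.
Proof. by move=> symS; rewrite hermformE /= bilinear_sym ?subrr. Qed.

Lemma reim_eq0 m n (w : 'M[R[i]]_(m, n)) : re w = 0 -> im w = 0 -> w = 0.
Proof. by move=> re0 im0; rewrite [w]mx_reim re0 im0 !map_mx0 scaler0 addr0. Qed.

Lemma re_hermform_gt0 n (S : 'M[R]_n) (w : 'rV[R[i]]_n) :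
  (forall x, x != 0 -> 0 < quadform S x) -> w != 0 ->
  0 < complex.Re (hermform S w).
Proof.
move=> S_gt0 w_neq0; rewrite re_hermform.
have S_ge0 x : 0 <= quadform S x.
  have [->|/S_gt0/ltW//] := eqVneq x 0.
  by rewrite /quadform mulmx0 mxE.
have [re0|re_neq0] := eqVneq (re w) 0; last first.
  by rewrite ltr_pwDl // S_gt0 // trmx_eq0.
rewrite ltr_wpDl // S_gt0 // trmx_eq0.
by apply: contraNN w_neq0 => /eqP im0; rewrite (reim_eq0 re0 im0).
Qed.

Lemma re_hermform_ge0 n (S : 'M[R]_n) (w : 'rV[R[i]]_n) :
  (forall x, 0 <= quadform S x) -> 0 <= complex.Re (hermform S w).
Proof. by move=> S_ge0; rewrite re_hermform addr_ge0. Qed.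

(** Two nonnegative real forms with sum zero both vanish, so the real and imaginary parts of [w] are
    each isotropic. *)
Lemma possemidef_hermform_isotropic n (S : 'M[R]_n) (w : 'rV[R[i]]_n) :
  sym_possemidef S -> complex.Re (hermform S w) = 0 -> w *m toC S = 0.
Proof.
move=> S_psd /eqP; rewrite re_hermform paddr_eq0 ?(proj2 S_psd) //.
move=> /andP[/eqP re_iso /eqP im_iso].
rewrite [w]mx_reim mulmxDl -scalemxAl -!map_mxM.
by rewrite !possemidef_isotropic // !map_mx0 scaler0 addr0.
Qed.

Lemma re_hermform_block n m (S : 'M[R]_n) (B : 'M[R]_(m, n)) (T : 'M[R]_m)
    (x : 'rV[R[i]]_n) (y : 'rV[R[i]]_m) :
  complex.Re (hermform (block_mx S B^T (- B) T) (row_mx x y))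
  = complex.Re (hermform S x) + complex.Re (hermform T y).
Proof.
by rewrite !re_hermform !map_row_mx !tr_row_mx !quadform_block addrACA.
Qed.

(** A point [k] of the open right half-plane is closer to [d > 0] than to [- d], and [lambda] is the
    Cayley quotient of [d - k] by [d + k]. *)
Lemma normc_cayley_lt1 (d k lambda : R[i]) :
  0 < complex.Re d -> complex.Im d = 0 -> 0 < complex.Re k ->
  lambda * (d + k) = d - k -> `|lambda| < 1.
Proof.
case: d k => [d d'] [a b] /= d_gt0 -> a_gt0 eq_dk.
have lt_dk : `|Complex d 0 - Complex a b| < `|Complex d 0 + Complex a b|.
  (* The squared moduli differ by [4 * d * a]. *)
  rewrite !normc_def /= ltcR ltr_sqrt; first by nra.
  by rewrite ltr_pwDl ?sqr_ge0 // exprn_gt0 // addr_gt0.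
have dk_gt0 := le_lt_trans (normr_ge0 _) lt_dk.
by rewrite -(ltr_pM2r dk_gt0) mul1r -normrM eq_dk.
Qed.

End ComplexForms.

Theorem theorem1 (R : realType) (n m : nat)
    (m_gt0 : (0 < m)%N) (le_mn : (m <= n)%N)
    (A : 'M[R]_n) (B : 'M[R]_(m, n)) (C : 'M[R]_m)
    (A_spd : sym_posdef A) (C_spsd : sym_possemidef C) (B_full : \rank B = m)
    (alpha beta : R) (alpha_gt0 : 0 < alpha) (beta_gt0 : 0 < beta)
    (lambda : R[i])
    (lambda_eig : complex_eigenvalue (iteration_mx A B C alpha beta) lambda) :
  `|lambda| < 1.
Proof.
have [A_sym A_gt0] := A_spd; have [C_sym C_ge0] := C_spsd.
pose toC p q := @map_mx _ _ (real_complex R) p q.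
pose D : 'M[R]_(n + m) := block_mx alpha%:M 0 0 beta%:M.
pose K := block_mx A B^T (- B) C.
have D_sym : D \is symmetricmx.
  by apply/symmetricmxP; rewrite /D tr_block_mx !tr_scalar_mx !trmx0.
(* The zero blocks are put in the shape that [quadform_block] expects. *)
have D_skewE : D = block_mx alpha%:M (0 : 'M_(m, n))^T (- 0) beta%:M.
  by rewrite trmx0 oppr0.
have D_gt0 (x : 'cV_(n + m)) : x != 0 -> 0 < quadform D x.
  rewrite -[x]vsubmxK D_skewE quadform_block col_mx_eq0 negb_and.
  have scal_ge0 k (a : R) (z : 'cV_k) : 0 < a -> 0 <= quadform a%:M z.
    have [->|z_neq0 a_gt0] := eqVneq z 0; first by rewrite /quadform mulmx0 mxE.
    by rewrite ltW // quadform_scalar_gt0.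
  by case/orP=> ?; [rewrite ltr_pwDl | rewrite ltr_wpDl];
    rewrite ?scal_ge0 ?quadform_scalar_gt0.
have K_ge0 (x : 'cV_(n + m)) : 0 <= quadform K x.
  rewrite -[x]vsubmxK quadform_block addr_ge0 //.
  have [->|/A_gt0/ltW//] := eqVneq (usubmx x) 0.
  by rewrite /quadform mulmx0 mxE.
have ME : split_M A B C alpha beta = 2^-1 *: (D + K).
  by rewrite /split_M add_block_mx !add0r.
have NE : split_N A B C alpha beta = 2^-1 *: (D - K).
  by rewrite /split_N opp_block_mx add_block_mx !add0r opprK.
have M_unit : split_M A B C alpha beta \in unitmx.
  rewrite ME unitmxZ; last by rewrite unitfE invr_eq0 pnatr_eq0.
  by apply: unitmx_quadform_gt0 => x x_neq0; rewrite quadformD ltr_pwDl ?D_gt0.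
have /eigenvalueP[v] := lambda_eig.
rewrite /iteration_mx map_mxM mulmxA.
(* Passing from [v] to [w], the product of [v] with the inverse of [split_M], clears the inverse
   from the eigenvalue equation. *)
set w := v *m _ => w_eig v_neq0.
have vE : v = w *m toC _ _ (split_M A B C alpha beta).
  by rewrite -mulmxA -map_mxM mulVmx // map_mx1 mulmx1.
have w_neq0 : w != 0 by apply: contraNneq v_neq0 => w0; rewrite vE w0 mul0mx.
have eq_w : w *m (toC _ _ D - toC _ _ K)
    = lambda *: (w *m (toC _ _ D + toC _ _ K)).
  have half_neq0 : real_complex R 2^-1 != 0.
    by rewrite fmorph_eq0 invr_eq0 pnatr_eq0.
  apply: (scalerI half_neq0).
  move: w_eig; rewrite vE ME NE /toC !map_mxZ map_mxB map_mxD -!scalemxAr => ->.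
  by rewrite !scalerA mulrC.
have [K_gt0|K_le0] := ltP 0 (complex.Re (hermform K w)).
  apply: (normc_cayley_lt1 (re_hermform_gt0 D_gt0 w_neq0)
    (im_hermform w D_sym) K_gt0).
  have := congr1 (fun u => (u *m (map_mx conjc w)^T) 0 0) eq_w.
  by rewrite -scalemxAl mulmxBr mulmxDr mulmxBl mulmxDl mx11Z !mx11D mx11N => <-.
pose x := lsubmx w; pose y := rsubmx w.
have wE : w = row_mx x y by rewrite hsubmxK.
(* A nonzero [x] would make the [A] part of the real part of the form positive, and the [C] part
   cannot offset it. *)
have x0 : x = 0.
  apply: contraTeq K_le0 => x_neq0; rewrite -ltNge wE re_hermform_block.
  by rewrite ltr_pwDl ?re_hermform_gt0 // re_hermform_ge0.
have y_neq0 : y != 0.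
  by apply: contraNneq w_neq0 => y0; rewrite wE x0 y0 row_mx0.
have yC0 : y *m toC _ _ C = 0.
  apply: possemidef_hermform_isotropic => //; apply/eqP.
  rewrite eq_le re_hermform_ge0 // andbT.
  move: K_le0; rewrite wE x0 re_hermform_block.
  by rewrite {1}/hermform !mul0mx mxE add0r.
(* The two blocks now read [y B = - lambda y B] and [beta y = lambda beta y]. The second gives
   [lambda = 1], and then the first gives [2 y B = 0]. *)
move: eq_w; rewrite wE x0 /toC !map_block_mx mulmxBr mulmxDr !mul_row_block.
rewrite !mul0mx -/(toC _ _ C) yC0 !map_mx0 !mulmx0 !add0r map_mxN mulmxN.
rewrite map_scalar_mx mul_mx_scalar opp_row_mx !add_row_mx !add0r opprK.
rewrite subr0 addr0 scale_row_mx => /eq_row_mx[yB_eq y_eq].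
have lambda1 : lambda = 1.
  have /eqP := y_eq; rewrite -subr_eq0 -[X in X - _]scale1r -scalerBl.
  rewrite scaler_eq0 scaler_eq0 (negPf y_neq0) orbF fmorph_eq0.
  by rewrite (gt_eqF beta_gt0) orbF subr_eq0 => /eqP.
have yB0 : y *m toC _ _ B = 0.
  apply/eqP; move/eqP: yB_eq; rewrite lambda1 scale1r -subr_eq0 opprK.
  by rewrite -mulr2n -scaler_nat scaler_eq0 pnatr_eq0.
(* The case is contradictory: row freeness of [B] survives the embedding into [R[i]], so [y B = 0]
   forces [y = 0]. *)
case/eqP: y_neq0; apply: (row_free_inj (A := toC _ _ B)).
  by rewrite row_free_map /row_free B_full.
by rewrite /= yB0 mul0mx.
Qed.
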